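(* Consider the Markov-modeled downlink with $N=2$ users and randomly delayed ARQ feedback described in the context (with $p>r$). For any distribution $P_D$ of the ARQ delay, the sum throughput $\eta_{\mathrm{sum}}(m,\{\mathfrak{A}_k\}_{k=1}^m)$ is maximized over all scheduling policies $\{\mathfrak{A}_k\}_{k=1}^m$ by the greedy policy $\{\widehat{\mathfrak{A}}_k\}_{k=1}^m$ (for every horizon $m$ and every initial belief vector $\pi_m\in[0,1]^2$).
   Context: Model. There are $N$ users. Time is slotted and slots are indexed in DEcreasing order $m,m-1,\ldots,1$, where $m$ is the horizon (slot $m$ is first, slot $1$ is last). The channel state of user $i$ in slot $t$ is $S_t(i)\in\{0,1\}$ ($1$ = ON, $0$ = OFF). The channels are independent across users, and each is a Markov chain with $P(S_t(i)=1\mid S_{t+1}(i)=1)=p$ and $P(S_t(i)=1\mid S_{t+1}(i)=0)=r$, with $p,r\in[0,1]$ and $p>r$. Initially $P(S_m(i)=1)=\pi_m(i)$. Scheduling and feedback. In each slot $t$ the scheduler, not knowing the channel states, schedules exactly one user $a_t\in\{1,\ldots,N\}$. The scheduled user generates the ARQ feedback bit $f_t=S_t(a_t)$ ($1$=ACK, $0$=NACK), which arrives, without error and stamped with its originating slot, at the end of slot $t-D(a_t,t)$ (delay $0$ means it arrives at the end of slot $t$ itself). The delays $D(i,t)$ are i.i.d. across users and time with probability mass function $P_D$ on $\{0,1,2,\ldots\}$ and independent of the channels. Beliefs. Let $T(x)=xp+(1-x)r$, $T^0(x)=x$, $T^u=T\circ T^{u-1}$. The belief $\pi_t(i)$ is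 the probability that user $i$'s channel is ON in slot $t$ given all feedback that has arrived by the beginning of slot $t$: if $k>t$ is the latest (most recent) slot from which feedback of user $i$ has arrived, then $\pi_t(i)=T^{k-t}(f_k)$; if no feedback of user $i$ has arrived, $\pi_t(i)=T^{m-t}(\pi_m(i))$. Policies and reward. A scheduling policy $\{\mathfrak{A}_k\}_{k=1}^m$ is a family of maps, where $\mathfrak{A}_k$ maps all the information available to the scheduler in slot $k$ (the belief vectors of slots $m,\ldots,k$ as held by the scheduler in slot $k$, and the past decisions $a_m,\ldots,a_{k+1}$) together with $k$ to a decision $a_k$. The expected immediate reward in slot $t$ is $R_t(\pi_t,a_t)=\pi_t(a_t)$; $V_m(\pi_m,\{\mathfrak{A}_k\}_{k=1}^m)$ is the expected total reward $E\big[\sum_{t=1}^m \pi_t(a_t)\big]$ under the policy, and $\eta_{\mathrm{sum}}(m,\{\mathfrak{A}_k\}_{k=1}^m)=V_m(\pi_m,\{\mathfrak{A}_k\}_{k=1}^m)/m$. Greedy policy. $\widehat{\mathfrak{A}}_k$ chooses $\hat a_k=\arg\max_i \pi_k(i)$ (ties broken arbitrarily). *)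

(* Defs.v *)
From HB Require Import structures.
From mathcomp Require Import all_boot all_order all_algebra.
From mathcomp Require Import all_classical all_reals all_analysis.

Set Implicit Arguments.
Unset Strict Implicit.
Unset Printing Implicit Defensive.

Import Order.TTheory GRing.Theory Num.Theory.
Import numFieldNormedType.Exports.
Local Open Scope classical_set_scope.
Local Open Scope ring_scope.

(* Slots are natural numbers used in decreasing order m, m-1, ..., 1, so that
   slot t.+1 immediately precedes slot t in time.  Users are 'I_N.  Throughout,
   [true] is ON (or ACK) and [false] is OFF (or NACK). *)

Definition belief_step (R : realType) (p r x : R) : R := x * p + (1 - x) * r.

Definition bit_val (R : realType) (b : bool) : R := if b then 1 else 0.
Arguments bit_val R b : clear implicits.

Definition trans_prob (R : realType) (p r : R) (b c : bool) : R :=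
  let on := if b then p else r in if c then on else 1 - on.

(* What the scheduler remembers of a past slot: its decision there and, if the
   feedback of that slot has arrived, [Some (delay, feedback bit)].  The delay
   records when the feedback arrived. *)
Record entry (N : nat) := Entry {
  eslot : nat;
  euser : 'I_N;
  eack : option (nat * bool)
}.

(* In slot k a policy is applied to the belief vectors of slots k, k+1, ..., m
   (in this order) as held in slot k, and to the entries of slots
   k+1, ..., m (in this order).  The entries contain the past decisions, and
   also the feedback received, so that a policy may use all the information
   available to the scheduler even where the belief values do not determine it
   (arrival times, or beliefs equal to 0 or 1 without feedback). *)
Definition policy (R : realType) (N : nat) :=
  nat -> seq 'rV[R]_N -> seq (entry N) -> 'I_N.

(* [pi] is the belief vector of the current slot. *)
Definition greedy (R : realType) (N : nat) (A : policy R N) : Prop :=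
  forall (k : nat) (pi : 'rV[R]_N) (pis : seq 'rV[R]_N) (h : seq (entry N))
         (i : 'I_N),
    pi 0 i <= pi 0 (A k (pi :: pis) h).

(* Belief of slot s.  The entries in h are listed from the most recent slot
   backwards in time, so the first match is the latest slot, no later in time
   than s (hence with an index at least s), from which feedback of user i has
   arrived.  For the current slot s = k all entries satisfy [k < eslot e]. *)
Definition belief (R : realType) (N : nat) (p r : R) (m : nat) (pi0 : 'rV[R]_N)
    (h : seq (entry N)) (s : nat) : 'rV[R]_N :=
  \row_(i < N)
    if [seq e <- h | [&& euser e == i, (s <= eslot e)%N & isSome (eack e)]]
       is Entry j _ (Some (_, f)) :: _
    then iter (j - s) (belief_step p r) (bit_val R f)
    else iter (m - s) (belief_step p r) (pi0 0 i).

Section SamplePath.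
Variables (R : realType) (N : nat) (p r : R) (m : nat) (pi0 : 'rV[R]_N).
Variable A : policy R N.
Variables (chan : nat -> 'I_N -> bool) (delay : 'I_N -> nat -> nat).

(* The feedback of slot s arrives at the end of slot s - delay a s, hence is
   available at the beginning of slot k iff s - delay a s > k; the addition
   avoids truncated subtraction.  [ds] lists (slot, decision) pairs. *)
Definition entries (k : nat) (ds : seq (nat * 'I_N)) : seq (entry N) :=
  [seq Entry sa.1 sa.2
         (if (k + delay sa.2 sa.1 < sa.1)%N
          then Some (delay sa.2 sa.1, chan sa.1 sa.2) else None) | sa <- ds].

Definition held_beliefs (k : nat) (h : seq (entry N)) : seq 'rV[R]_N :=
  [seq belief p r m pi0 h s | s <- iota k (m - k).+1].

Definition decide (k : nat) (ds : seq (nat * 'I_N)) : 'I_N :=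
  A k (held_beliefs k (entries k ds)) (entries k ds).

(* The decisions of the first n slots m, ..., m-n+1, most recent first. *)
Fixpoint decisions (n : nat) : seq (nat * 'I_N) :=
  if n is n'.+1
  then (m - n', decide (m - n') (decisions n'))%N :: decisions n'
  else [::].

Definition decision (t : nat) : 'I_N := decide t (decisions (m - t)).

Definition current_belief (t : nat) : 'rV[R]_N :=
  belief p r m pi0 (entries t (decisions (m - t))) t.

Definition total_reward : R :=
  \sum_(1 <= t < m.+1) current_belief t 0 (decision t).

End SamplePath.

(* The joint law of the channels in slots m, ..., 1 and of the delays. *)
Record downlink_model (R : realType) (N : nat) (p r : R) (PD : nat -> R)
    (m : nat) (pi0 : 'rV[R]_N)
    (d : measure_display) (Omega : measurableType d) (P : probability Omega R)
    (chan : nat -> 'I_N -> Omega -> bool)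
    (delay : 'I_N -> nat -> Omega -> nat) : Prop := DownlinkModel {
  chan_measurable : forall (t : nat) (i : 'I_N), (1 <= t <= m)%N ->
    measurable_fun setT (chan t i);
  delay_measurable : forall (i : 'I_N) (t : nat), (1 <= t <= m)%N ->
    measurable_fun setT (delay i t);
  chan_initial : forall i : 'I_N,
    P [set w | chan m i w = true] = (pi0 0 i)%:E;
  (* Conditionally on any past of user i's channel, its state in slot t has the
     law [trans_prob p r (state in slot t.+1)]; multiplied out, so that pasts
     of probability 0 are unconstrained. *)
  chan_markov : forall (i : 'I_N) (t : nat) (x : nat -> bool),
    (1 <= t < m)%N ->
    P [set w | forall s, (t <= s <= m)%N -> chan s i w = x s] =
    ((trans_prob p r (x t.+1) (x t))%:E *
     P [set w | forall s, (t < s <= m)%N -> chan s i w = x s])%E;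
  delay_law : forall (i : 'I_N) (t n : nat), (1 <= t <= m)%N ->
    P [set w | delay i t w = n] = (PD n)%:E;
  (* Mutual independence of the N channel processes (as random paths) and of
     all the delays; taking full sets gives every subfamily. *)
  model_independent : forall (C : 'I_N -> set {ffun 'I_m -> bool})
                             (B : 'I_N -> 'I_m -> set nat),
    P [set w | (forall i, C i [ffun t : 'I_m => chan t.+1 i w]) /\
               (forall i (t : 'I_m), B i t (delay i t.+1 w))] =
    ((\prod_(i < N) P [set w | C i [ffun t : 'I_m => chan t.+1 i w]]) *
     (\prod_(i < N) \prod_(t < m) P [set w | B i t (delay i t.+1 w)]))%E
}.

Definition is_pmf (R : realType) (f : nat -> R) : Prop :=
  (forall n, 0 <= f n) /\ (\sum_(0 <= n <oo) (f n)%:E = 1)%E.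

Definition expected_reward (R : realType) (N : nat) (p r : R) (m : nat)
    (pi0 : 'rV[R]_N) (d : measure_display) (Omega : measurableType d)
    (P : probability Omega R) (chan : nat -> 'I_N -> Omega -> bool)
    (delay : 'I_N -> nat -> Omega -> nat) (A : policy R N) : \bar R :=
  ('E_P[fun w => total_reward p r m pi0 A (fun t i => chan t i w)
                                          (fun i t => delay i t w)])%E.

Definition sum_throughput (R : realType) (N : nat) (p r : R) (m : nat)
    (pi0 : 'rV[R]_N) (d : measure_display) (Omega : measurableType d)
    (P : probability Omega R) (chan : nat -> 'I_N -> Omega -> bool)
    (delay : 'I_N -> nat -> Omega -> nat) (A : policy R N) : \bar R :=
  (expected_reward p r m pi0 P chan delay A * (m%:R^-1)%:E)%E.

(* Main.v *)
(* Fix a target slot k and keep only the feedback that arrives before it.  The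
   greedy user at k has the largest belief there, so it suffices that the
   expectation of the largest belief at k is the same under every policy.
   Observing one user at slot t, and nothing later, makes the largest belief
   at k equal on average to the (t-k)-step propagation of the probability that
   at least one of the two users is ON at t, which is symmetric in the users;
   and whether the feedback of slot t arrives in time has a probability that
   does not depend on the user chosen.  Hence the expected largest belief,
   computed slot by slot along the belief process, never sees the decisions.
   The belief process is Markov because, given the feedback received, the
   channel states are independent with the beliefs as parameters. *)

Require Import Defs.
From HB Require Import structures.
From mathcomp Require Import all_boot all_order all_algebra.
From mathcomp Require Import all_classical all_reals all_analysis.
From mathcomp Require Import ring lra zify.

Set Implicit Arguments.
Unset Strict Implicit.
Unset Printing Implicit Defensive.

Import Order.TTheory GRing.Theory Num.Theory.
Import numFieldNormedType.Exports.
Local Open Scope classical_set_scope.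
Local Open Scope ring_scope.

(** * The two-user value function *)

Definition bernoulli_weight (R : realType) (b : R) (x : bool) : R :=
  if x then b else 1 - b.

Section BeliefStep.
Variables (R : realType) (p r : R).
Local Notation T := (belief_step p r).

Lemma sum_bernoulli_weight (b : R) : \sum_(c : bool) bernoulli_weight b c = 1.
Proof. by rewrite big_bool /=; ring. Qed.

Lemma sum_bernoulli_trans (b : R) (x : bool) :
  \sum_(c : bool) bernoulli_weight b c * trans_prob p r c x =
  bernoulli_weight (T b) x.
Proof.
by rewrite big_bool /trans_prob /bernoulli_weight /belief_step; case: x => /=;
  ring.
Qed.

Lemma bernoulli_weight_step (b x : bool) :
  bernoulli_weight (T (bit_val R b)) x = trans_prob p r b x.
Proof.
by rewrite /bernoulli_weight /belief_step /trans_prob; case: b x => [] [] /=;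
  ring.
Qed.

Lemma iter_step_affine (n : nat) (x : R) :
  iter n T x = x * iter n T 1 + (1 - x) * iter n T 0.
Proof.
elim: n => [|n IHn] /=; first by ring.
by rewrite {1}IHn /belief_step; ring.
Qed.

Lemma iter_step_le (n : nat) (x y : R) : r <= p -> x <= y ->
  iter n T x <= iter n T y.
Proof. by move=> rp xy; elim: n => //= n IHn; rewrite /belief_step; nra. Qed.

Lemma iter_step_ge0_le1 (n : nat) (x : R) : 0 <= p <= 1 -> 0 <= r <= 1 ->
  0 <= x <= 1 -> 0 <= iter n T x <= 1.
Proof.
move=> p01 r01 x01; elim: n => //= n.
by set y := iter n T x; rewrite /belief_step => ?; apply/andP; split; nra.
Qed.

End BeliefStep.

Section TwoUserValue.
Variables (R : realType) (p r : R) (F : nat -> R).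
Local Notation T := (belief_step p r).

(* The expected maximal belief [n] slots ahead when the beliefs are [x] and [y]
   and the feedback of the [l]-th slot before the target arrives in time with
   probability [F l], always probing the first user. *)
Fixpoint value (n : nat) (x y : R) : R :=
  if n is l.+1 then
    (1 - F n) * value l (T x) (T y) +
    F n * (x * value l (T 1) (T y) + (1 - x) * value l (T 0) (T y))
  else Num.max x y.

(** The first user, of belief [x], is observed; [j] slots then pass without further observation, and
    the value is taken with [n] slots left. The arrival branch of [value] is the case [j = 1];
    general [j] is what makes the induction for symmetry close. *)
Definition probe (n j : nat) (x y : R) : R :=
  x * value n (iter j T 1) (iter j T y) +
  (1 - x) * value n (iter j T 0) (iter j T y).

Lemma value_probe (n : nat) (x y : R) :
  value n.+1 x y =
  (1 - F n.+1) * value n (T x) (T y) + F n.+1 * probe n 1 x y.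
Proof. by []. Qed.

Lemma probe_affine (n j : nat) (x y z w : R) :
  w * probe n j x z + (1 - w) * probe n j y z =
  probe n j (w * x + (1 - w) * y) z.
Proof. by rewrite /probe; ring. Qed.

Hypotheses (p01 : 0 <= p <= 1) (r01 : 0 <= r <= 1) (rp : r <= p).

(* For [n = 0] both sides are the [j]-step propagation of the probability
   [x + y - x * y] that some user is ON. *)
Lemma probeC (n j : nat) (x y : R) : 0 <= x <= 1 -> 0 <= y <= 1 ->
  probe n j x y = probe n j y x.
Proof.
elim: n j x y => [|n IHn] j x y x01 y01.
  (* By monotonicity of the propagation, a user seen ON wins the maximum and a user seen OFF loses
     it. *)
  have probe0 u v : 0 <= v <= 1 ->
      probe 0 j u v = u * iter j T 1 + (1 - u) * iter j T v.
    move=> /andP[v0 v1]; rewrite /probe /= max_l ?max_r //.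
    - exact: iter_step_le.
    - exact: iter_step_le.
  rewrite !probe0 // (iter_step_affine p r j x) (iter_step_affine p r j y).
  by ring.
(* If the next feedback is not received, the first observation only gets older. If it is received,
   affinity averages the earlier observation of the same user away and leaves a fresh probe of the
   propagated beliefs. *)
have probeS u v : probe n.+1 j u v =
    (1 - F n.+1) * probe n j.+1 u v +
    F n.+1 * probe n 1 (iter j T u) (iter j T v).
  rewrite (iter_step_affine p r j u) -probe_affine /probe !value_probe /probe /=.
  by ring.
rewrite !probeS IHn //; congr (_ + _ * _).
by apply: IHn; apply: iter_step_ge0_le1.
Qed.

Lemma valueC (n : nat) (x y : R) : 0 <= x <= 1 -> 0 <= y <= 1 ->
  value n x y = value n y x.
Proof.
elim: n x y => [|n IHn] x y x01 y01; first by rewrite /= maxC.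
rewrite !value_probe (probeC _ _ x01 y01) IHn //.
- exact: (iter_step_ge0_le1 1 p01 r01 x01).
- exact: (iter_step_ge0_le1 1 p01 r01 y01).
Qed.

End TwoUserValue.

(** * Configurations and histories *)

(** Slots decrease as time passes, so induction along time starts at [m] and goes down. *)
Lemma downward_ind (P : nat -> Prop) (k m : nat) :
  P m -> (forall t, (k <= t < m)%N -> P t.+1 -> P t) ->
  forall t, (k <= t <= m)%N -> P t.
Proof.
move=> Pm IH t /andP[kt tm]; rewrite -(subKn tm).
have : (m - t <= m - k)%N by lia.
elim: (m - t)%N => [_|n IHn nk]; first by rewrite subn0.
apply: IH; first by lia.
have -> : (m - n.+1).+1 = (m - n)%N by lia.
by apply: IHn; lia.
Qed.

Section Observations.
Variables (R : realType) (N m : nat) (p r : R) (pi0 : 'rV[R]_N).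
Variable A : policy R N.

(* All the channel states and delays, the delays being capped at [m] because
   larger ones are indistinguishable; the component at slot 0 is junk. *)
Definition config := {ffun 'I_m.+1 -> {ffun 'I_N -> bool * 'I_m.+1}}.

Definition config_chan (z : config) (t : nat) (i : 'I_N) : bool :=
  (z (inord t) i).1.
Definition config_delay (z : config) (i : 'I_N) (t : nat) : nat :=
  (z (inord t) i).2.
Definition config_state (z : config) (t : nat) : {ffun 'I_N -> bool} :=
  [ffun i => config_chan z t i].

(* The feedback that has arrived by the beginning of slot [k] from the slots
   before slot [t], where [k <= t]. *)
Definition history (k t : nat) (z : config) : seq (entry N) :=
  entries (config_chan z) (config_delay z) k
    (decisions p r m pi0 A (config_chan z) (config_delay z) (m - t)).

(* Recovers what the scheduler held in slot [t] from what it holds later, by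
   deleting the feedback that arrived in between. *)
Definition forget (t : nat) (e : entry N) : entry N :=
  Entry (eslot e) (euser e)
    (if eack e is Some (d, f) then
       if (t + d < eslot e)%N then Some (d, f) else None
     else None).

Definition next_user (t : nat) (h : seq (entry N)) : 'I_N :=
  let h' := [seq forget t e | e <- h] in A t (held_beliefs p r m pi0 t h') h'.

Definition new_entry (t : nat) (i : 'I_N) (x : {ffun 'I_N -> bool}) (n : nat)
    (o : option 'I_n) : entry N :=
  Entry t i (omap (fun d : 'I_n => (nat_of_ord d, x i)) o).

(** The feedback of slot [t] is available in slot [k] exactly when its delay is below [t - k];
    [None] lumps all larger delays together. *)
Definition arrival (k t : nat) (i : 'I_N) (z : config) : option 'I_(t - k) :=
  insub (config_delay z i t).

Lemma forget_entries (k t : nat) chan delay (ds : seq (nat * 'I_N)) :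
  (k <= t)%N -> [seq forget t e | e <- entries chan delay k ds] =
  entries chan delay t ds.
Proof.
move=> kt; rewrite /entries -map_comp; apply: eq_map => -[s i] /=.
rewrite /forget /=; congr Entry.
case: ifPn => // ksd; case: ifPn => //; lia.
Qed.

Lemma decision_next_user (k t : nat) (z : config) : (k <= t)%N ->
  decision p r m pi0 A (config_chan z) (config_delay z) t =
  next_user t (history k t z).
Proof. by move=> kt; rewrite /next_user /history forget_entries. Qed.

Lemma history_nil (k : nat) (z : config) : history k m z = [::].
Proof. by rewrite /history subnn. Qed.

(** With the observation slot [k] held fixed, each extension of the history is a function of the
    shorter history and of the states and arrival of one slot. This works because the past decision
    can be recomputed through [forget]. *)
Lemma historyS (k t : nat) (z : config) : (k <= t < m)%N ->
  history k t z =
  let h := history k t.+1 z in let i := next_user t.+1 h in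
  new_entry t.+1 i (config_state z t.+1) (arrival k t.+1 i z) :: h.
Proof.
move=> /andP[kt tm] /=.
rewrite -decision_next_user ?(leqW kt)// /history /new_entry.
have -> : (m - t)%N = (m - t.+1).+1 by lia.
rewrite /= -/(decision _ _ _ _ _ _ _ _).
have -> : (m - (m - t.+1))%N = t.+1 by lia.
congr cons; rewrite -/(decision p r m pi0 A _ _ t.+1).
congr Entry; rewrite ffunE /arrival.
set d := config_delay _ _ _.
have -> : (k + d < t.+1)%N = (d < t.+1 - k)%N by lia.
case: insubP => [d' dlt dE|/negbTE dlt] /=; by [rewrite -dE ifT ?dE|rewrite dlt].
Qed.

Lemma history_slot (k t : nat) (z : config) : (k <= t <= m)%N ->
  all (fun e => t < eslot e)%N (history k t z).
Proof.
move: t; apply: downward_ind => [|t ktm IH]; first by rewrite history_nil.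
rewrite historyS //= ltnSn; apply: sub_all IH => e; exact: ltnW.
Qed.

Definition agree_before (t : nat) (z y : config) : Prop :=
  forall s, (t < s <= m)%N -> z (inord s) = y (inord s).

Lemma history_local (k t : nat) (z y : config) : (k <= t <= m)%N ->
  agree_before t z y -> history k t z = history k t y.
Proof.
move: t; apply: downward_ind => [_|t ktm IH zy]; first by rewrite !history_nil.
rewrite (historyS z ktm) (historyS y ktm) /= IH => [|s /andP[/ltnW ts sm]];
  last by apply: zy; rewrite ts.
have zyt : z (inord t.+1) = y (inord t.+1) by apply: zy; lia.
by rewrite /config_state /arrival /config_delay /config_chan zyt.
Qed.

End Observations.

(** * Beliefs as conditional laws *)

Section Beliefs.
Variables (R : realType) (N m : nat) (p r : R) (pi0 : 'rV[R]_N).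
Local Notation belief := (belief p r m pi0).
Local Notation T := (belief_step p r).

Lemma belief_nil : belief [::] m = pi0.
Proof. by apply/rowP => i; rewrite mxE /= subnn. Qed.

(** All entries are older than slot [t], so both beliefs are read off the same entry and differ by
    one propagation step. *)
Lemma belief_older (t : nat) (h : seq (entry N)) (i : 'I_N) :
  (t < m)%N -> all (fun e => t < eslot e)%N h ->
  belief h t 0 i = T (belief h t.+1 0 i).
Proof.
move=> tm ht; rewrite !mxE.
elim: h ht => [|e h IH] /=; first by have -> : (m - t)%N = (m - t.+1).+1 by lia.
move=> /andP[te ht]; rewrite te (ltnW te) /=.
case: ifP => [/andP[_]|_]; last exact: IH.
case: e te => s j [[d f]|] //= te _.
by have -> : (s - t)%N = (s - t.+1).+1 by lia.
Qed.

Lemma belief_new_entry (t n : nat) (j : 'I_N) (x : {ffun 'I_N -> bool})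
    (o : option 'I_n) (h : seq (entry N)) (i : 'I_N) :
  (t < m)%N -> all (fun e => t < eslot e)%N h ->
  belief (new_entry t.+1 j x o :: h) t 0 i =
  T (if (i == j) && isSome o then bit_val R (x j) else belief h t.+1 0 i).
Proof.
move=> tm ht; case: ifPn => [/andP[/eqP-> so]|io].
  by rewrite mxE /= eqxx leqnSn; case: o so => //= d _; rewrite subSnn.
rewrite -belief_older // !mxE /= leqnSn eq_sym.
by case: o io => [d|] /=; [rewrite andbT => /negbTE-> | rewrite !andbF].
Qed.

Lemma belief_ge0_le1 (h : seq (entry N)) (s : nat) (i : 'I_N) :
  0 <= p <= 1 -> 0 <= r <= 1 -> 0 <= pi0 0 i <= 1 -> 0 <= belief h s 0 i <= 1.
Proof.
move=> p01 r01 b01; rewrite mxE.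
case: [seq e <- h | _] => [|[j _ [[_ f]|]] _]; apply: iter_step_ge0_le1 => //.
by case: f; rewrite /= ?lexx ?ler01.
Qed.

End Beliefs.

(** Absorbing [phi] into the factor at [j] leaves a sum of products, to which distributivity
    applies. *)
Lemma sum_prod_ffun_at (R : comPzRingType) (I C : finType) (j : I) (phi : C -> R)
    (F : I -> C -> R) :
  \sum_(y : {ffun I -> C}) phi (y j) * \prod_i F i (y i) =
  (\sum_c phi c * F j c) * \prod_(i | i != j) \sum_c F i c.
Proof.
transitivity (\sum_(y : {ffun I -> C})
    \prod_i (if i == j then phi (y i) * F i (y i) else F i (y i))).
  apply: eq_bigr => y _; rewrite (bigD1 j) // [RHS](bigD1 j) //= eqxx mulrA.
  by congr (_ * _); apply: eq_bigr => i /negbTE->.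
rewrite -(bigA_distr_bigA (fun i c => if i == j then phi c * F i c else F i c)).
rewrite (bigD1 j) //=; congr (_ * _); first by apply: eq_bigr => c _; rewrite eqxx.
by apply: eq_bigr => i /negbTE ij; apply: eq_bigr => c _; rewrite ij.
Qed.

(** * The law of configurations slot by slot, and calibration of the beliefs *)

Section Chain.
Variables (R : realType) (N m : nat) (p r : R) (pi0 : 'rV[R]_N).
Variables (PD : nat -> R) (W : config N m -> R).

Definition state_weight (z : config N m) (t : nat) (x : {ffun 'I_N -> bool}) :
    R :=
  \prod_i (if t == m then bernoulli_weight (pi0 0 i) (x i)
           else trans_prob p r (config_chan z t.+1 i) (x i)).

Definition belief_weight (b : 'rV[R]_N) (x : {ffun 'I_N -> bool}) : R :=
  \prod_i bernoulli_weight (b 0 i) (x i).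

Definition arrival_weight (n : nat) (o : option 'I_n) : R :=
  if o is Some d then PD d else 1 - \sum_(d < n) PD d.

Definition depends_before (t : nat) (psi : config N m -> R) : Prop :=
  forall z y, agree_before t z y -> psi z = psi y.

Definition mean (f : config N m -> R) : R := \sum_z W z * f z.

(** The interface between the probability space and the combinatorial argument. The delay law is
    restricted to [d < m] because the capped value [m] stands for all delays from [m] on. *)
Record sequential_law : Prop := SequentialLaw {
  state_law : forall (t : nat) (psi : config N m -> R) x,
    (0 < t <= m)%N -> depends_before t psi ->
    mean (fun z => psi z * (config_state z t == x)%:R) =
    mean (fun z => psi z * state_weight z t x);
  state_delay_law : forall (t : nat) (psi : config N m -> R) x i d,
    (0 < t <= m)%N -> (d < m)%N -> depends_before t psi ->
    mean (fun z => psi z * (config_state z t == x)%:R *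
                   (config_delay z i t == d)%:R) =
    PD d * mean (fun z => psi z * state_weight z t x)
}.

Lemma eq_mean (f g : config N m -> R) : f =1 g -> mean f = mean g.
Proof. by move=> fg; apply: eq_bigr => z _; rewrite fg. Qed.

Lemma meanZ (a : R) (f : config N m -> R) :
  mean (fun z => a * f z) = a * mean f.
Proof. by rewrite /mean mulr_sumr; apply: eq_bigr => z _; rewrite mulrCA. Qed.

Lemma meanB (f g : config N m -> R) :
  mean (fun z => f z - g z) = mean f - mean g.
Proof. by rewrite /mean -sumrB; apply: eq_bigr => z _; rewrite mulrBr. Qed.

Lemma mean_sum (I : finType) (f : I -> config N m -> R) :
  mean (fun z => \sum_i f i z) = \sum_i mean (f i).
Proof.
by rewrite /mean exchange_big; apply: eq_bigr => z _; rewrite mulr_sumr.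
Qed.

Lemma insub_eqE (n d : nat) (o : option 'I_n) :
  ((insub d == o)%:R : R) =
  if o is Some e then (d == e)%:R else 1 - \sum_(e < n) (d == e)%:R.
Proof.
case: o => [e|].
  case: insubP => [e' _ <-|dn] //=.
  by case: eqP dn => // ->; rewrite ltn_ord.
case: insubP => [e' _ <-|dn] /=.
  rewrite (bigD1 e') //= eqxx big1 ?addr0 ?subrr // => e ne.
  suff /negbTE-> : e' != e :> nat by [].
  by apply: contraNneq ne => /val_inj ->.
rewrite big1 ?subr0 // => e _.
by case: eqP dn => // ->; rewrite ltn_ord.
Qed.

Hypothesis lawW : sequential_law.

Lemma state_arrival_law (k t : nat) (psi : config N m -> R) x i o :
  (0 < k < t)%N -> (t <= m)%N -> depends_before t psi ->
  mean (fun z => psi z * (config_state z t == x)%:R *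
                 (arrival k t i z == o)%:R) =
  arrival_weight o * mean (fun z => psi z * state_weight z t x).
Proof.
move=> kt tm psit; have t0m : (0 < t <= m)%N by lia.
(* A delay below [t - k] is below [m], so capping has not altered it. *)
have law1 (d : 'I_(t - k)) := state_delay_law lawW x i t0m
  (leq_trans (ltn_ord d) (leq_trans (leq_subr k t) tm)) psit.
case: o => [d|] /=.
  by rewrite -law1; apply: eq_mean => z; rewrite insub_eqE.
rewrite mulrBl mul1r mulr_suml; under eq_bigr do rewrite -law1.
rewrite -(state_law lawW _ t0m psit) -mean_sum -meanB; apply: eq_mean => z.
by rewrite insub_eqE mulrBr mulr1 mulr_sumr.
Qed.

Variable A : policy R N.
Local Notation history := (history p r pi0 A).
Local Notation next_user := (next_user m p r pi0 A).

Lemma depends_before_history (k t : nat) (g : seq (entry N) -> R) :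
  (k <= t <= m)%N -> depends_before t (fun z => g (history k t z)).
Proof. by move=> ktm z y zy; rewrite (history_local _ _ _ _ ktm zy). Qed.

(** The slot law concerns a fixed user, whereas the scheduled one depends on the history. Splitting
    by indicators of the states, the arrival and the scheduled user makes that user constant in each
    term and leaves a test function of the past. *)
Lemma mean_historyS (k t : nat)
    (g : seq (entry N) -> {ffun 'I_N -> bool} -> R) :
  (0 < k)%N -> (k <= t < m)%N ->
  mean (fun z => g (history k t z) (config_state z t.+1)) =
  \sum_x \sum_(o : option 'I_(t.+1 - k)) arrival_weight o *
    mean (fun z => let h := history k t.+1 z in
      g (new_entry t.+1 (next_user t.+1 h) x o :: h) x * state_weight z t.+1 x).
Proof.
move=> k0 ktm; pose h (z : config N m) := history k t.+1 z.
transitivity (\sum_x \sum_(o : option 'I_(t.+1 - k)) \sum_i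
  mean (fun z => ((next_user t.+1 (h z) == i)%:R *
       g (new_entry t.+1 i x o :: h z) x) *
    (config_state z t.+1 == x)%:R * (arrival k t.+1 i z == o)%:R)).
  transitivity (mean (fun z => \sum_x \sum_(o : option 'I_(t.+1 - k)) \sum_i
    ((next_user t.+1 (h z) == i)%:R *
       g (new_entry t.+1 i x o :: h z) x) *
    (config_state z t.+1 == x)%:R * (arrival k t.+1 i z == o)%:R)); last first.
    rewrite mean_sum; apply: eq_bigr => x _.
    by rewrite mean_sum; apply: eq_bigr => o _; rewrite mean_sum.
  apply: eq_mean => z; rewrite (historyS _ _ _ _ z ktm) /= -/(h z).
  rewrite (bigD1 (config_state z t.+1)) //= [X in _ + X]big1 ?addr0 => [|x nx];
    last by apply: big1 => o _; apply: big1 => i _;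
      rewrite [config_state _ _ == _]eq_sym (negbTE nx) mulr0 mul0r.
  rewrite (bigD1 (arrival k t.+1 (next_user t.+1 (h z)) z)) //=.
  rewrite [X in _ + X]big1 ?addr0 => [|o no]; last first.
    apply: big1 => i _; case: eqP => [<-|_]; last by rewrite !mul0r.
    by rewrite [arrival _ _ _ _ == _]eq_sym (negbTE no) mulr0.
  rewrite (bigD1 (next_user t.+1 (h z))) //= [X in _ + X]big1 ?addr0 => [|i ni];
    last by rewrite eq_sym (negbTE ni) !mul0r.
  by rewrite !eqxx mul1r !mulr1.
apply: eq_bigr => x _; apply: eq_bigr => o _.

rewrite (eq_bigr (fun i => arrival_weight o * mean (fun z =>
    (next_user t.+1 (h z) == i)%:R * g (new_entry t.+1 i x o :: h z) x *
    state_weight z t.+1 x))); last first.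
  move=> i _; apply: state_arrival_law; [lia|lia|].
  apply: (@depends_before_history k t.+1 (fun h =>
    (next_user t.+1 h == i)%:R * g (new_entry t.+1 i x o :: h) x)).
  by lia.
rewrite -mulr_sumr; congr (_ * _); rewrite -mean_sum; apply: eq_mean => z /=.
rewrite -/(h z) (bigD1 (next_user t.+1 (h z))) //= eqxx mul1r.
rewrite big1 ?addr0 // => i ni.
by rewrite eq_sym (negbTE ni) !mul0r.
Qed.

Lemma sum_belief_weight (b : 'rV[R]_N) (j : 'I_N) (phi : bool -> R) :
  \sum_(y : {ffun 'I_N -> bool}) phi (y j) * belief_weight b y =
  \sum_c phi c * bernoulli_weight (b 0 j) c.
Proof.
rewrite (sum_prod_ffun_at j phi (fun i => bernoulli_weight (b 0 i))).
by rewrite [X in _ * X]big1 ?mulr1 // => i _; apply: sum_bernoulli_weight.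
Qed.

(** Given the history, the states of slot [t] are independent with the beliefs as parameters, tested
    against every [g]. Here [state_weight] is the conditional probability of [x] given the true
    past, hidden states included. *)
Definition calibrated (k t : nat) : Prop :=
  forall (g : seq (entry N) -> R) x,
  mean (fun z => g (history k t z) * state_weight z t x) =
  mean (fun z => g (history k t z) *
                 belief_weight (belief p r m pi0 (history k t z) t) x).

Lemma mean_historyS_calibrated (k t : nat)
    (g : seq (entry N) -> {ffun 'I_N -> bool} -> R) :
  (0 < k)%N -> (k <= t < m)%N -> calibrated k t.+1 ->
  mean (fun z => g (history k t z) (config_state z t.+1)) =
  mean (fun z => let h := history k t.+1 z in
    \sum_(o : option 'I_(t.+1 - k)) arrival_weight o *
    \sum_x g (new_entry t.+1 (next_user t.+1 h) x o :: h) x *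
           belief_weight (belief p r m pi0 h t.+1) x).
Proof.
move=> k0 ktm cal; rewrite mean_historyS // exchange_big mean_sum /=.
apply: eq_bigr => o _; rewrite meanZ mean_sum mulr_sumr.
apply: eq_bigr => x _; congr (_ * _).
exact: (cal (fun h => g (new_entry t.+1 (next_user t.+1 h) x o :: h) x)).
Qed.

Lemma belief_next_entry (k t n : nat) (j i : 'I_N) (y : {ffun 'I_N -> bool})
    (o : option 'I_n) (z : config N m) :
  (k <= t < m)%N ->
  belief p r m pi0 (new_entry t.+1 j y o :: history k t.+1 z) t 0 i =
  belief_step p r (if (i == j) && isSome o then bit_val R (y j)
                   else belief p r m pi0 (history k t.+1 z) t.+1 0 i).
Proof.
move=> ktm; apply: belief_new_entry; first by lia.
have ktm1 : (k <= t.+1 <= m)%N by lia.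
by apply: sub_all (history_slot p r pi0 A z ktm1) => e /ltnW.
Qed.

(** Induction along time. The new entry involves the states of slot [t.+1] only through the
    scheduled user [j], so the sum over these states splits into one factor per user and
    independence is preserved. *)
Lemma history_calibrated (k t : nat) : (0 < k)%N -> (k <= t <= m)%N ->
  calibrated k t.
Proof.
move=> k0; move: t; apply: downward_ind => [|t ktm IH] g x.
  apply: eq_mean => z; rewrite history_nil belief_nil.
  by congr (_ * _); apply: eq_bigr => i _; rewrite eqxx.
pose g1 h (y : {ffun 'I_N -> bool}) := g h * \prod_i trans_prob p r (y i) (x i).
pose g2 h (y : {ffun 'I_N -> bool}) :=
  g h * belief_weight (belief p r m pi0 h t) x.
transitivity (mean (fun z => g1 (history k t z) (config_state z t.+1))).
  apply: eq_mean => z; congr (_ * _); apply: eq_bigr => i _.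
  by rewrite ffunE ifF //; lia.
transitivity (mean (fun z => g2 (history k t z) (config_state z t.+1))); last by [].
rewrite !mean_historyS_calibrated //; apply: eq_mean => z /=.
apply: eq_bigr => o _; congr (_ * _); rewrite /g1 /g2.
set h := history k t.+1 z; set j := next_user _ _.
pose b i := belief p r m pi0 h t.+1 0 i.
(* A constant state vector can replace [y], since the entry reads only coordinate [j]. *)
pose phi (c : bool) := g (new_entry t.+1 j [ffun=> c] o :: h).
have phiE (y : {ffun 'I_N -> bool}) : g (new_entry t.+1 j y o :: h) = phi (y j).
  by rewrite /phi /new_entry; case: o {phi} => [d|] //=; rewrite ffunE.
pose next i (c : bool) := bernoulli_weight (belief_step p r
  (if (i == j) && isSome o then bit_val R c else b i)) (x i).
pose now i c := trans_prob p r c (x i) * bernoulli_weight (b i) c.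
pose nxt i c := next i c * bernoulli_weight (b i) c.
transitivity (\sum_(y : {ffun 'I_N -> bool}) phi (y j) * \prod_i now i (y i)).
  by apply: eq_bigr => y _; rewrite phiE -mulrA -big_split.
transitivity (\sum_(y : {ffun 'I_N -> bool}) phi (y j) * \prod_i nxt i (y i));
  last first.
  apply: eq_bigr => y _; rewrite phiE -mulrA -big_split; congr (_ * _).
  apply: eq_bigr => i _; rewrite belief_next_entry // -/h -/(b i) /nxt /next.
  by congr (bernoulli_weight (belief_step _ _ _) _ * _); case: eqVneq => //= ->.
rewrite !sum_prod_ffun_at {}/now {}/nxt.
have sum_next i : (i == j) && isSome o = false ->
    \sum_c trans_prob p r c (x i) * bernoulli_weight (b i) c =
    \sum_c next i c * bernoulli_weight (b i) c.
  move=> io; rewrite /next io -mulr_sumr sum_bernoulli_weight mulr1.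
  by rewrite -sum_bernoulli_trans; apply: eq_bigr => c _; rewrite mulrC.
(* For users other than [j] the factors agree after summing out the hidden state. For [j] they agree
   term by term if the bit arrived; otherwise [phi] is constant and the same summation applies. *)
congr (_ * _); last by apply: eq_bigr => i /negbTE ij; rewrite sum_next ?ij.
case: o @phi {phiE} @next sum_next => [d|] phi next sum_next.
  by apply: eq_bigr => c _; rewrite /next eqxx /= bernoulli_weight_step.
by rewrite /phi /new_entry /= -!mulr_sumr sum_next ?andbF.
Qed.

Lemma mean_history_step (k t : nat) (g : seq (entry N) -> R) :
  (0 < k)%N -> (k <= t < m)%N ->
  mean (fun z => g (history k t z)) =
  mean (fun z => let h := history k t.+1 z in
    \sum_(o : option 'I_(t.+1 - k)) arrival_weight o *
    \sum_x g (new_entry t.+1 (next_user t.+1 h) x o :: h) *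
           belief_weight (belief p r m pi0 h t.+1) x).
Proof.
move=> k0 ktm; apply: (mean_historyS_calibrated (fun h _ => g h)) => //.
by apply: history_calibrated => //; lia.
Qed.

End Chain.

(** * Policy independence for two users *)

Lemma big_option (R : nmodType) (I : finType) (F : option I -> R) :
  \sum_(o : option I) F o = F None + \sum_i F (Some i).
Proof.
rewrite (bigD1 None) //=; congr (_ + _).
rewrite (reindex_omap Some id) => [|[i|] //].
by apply: eq_bigl => i; rewrite eqxx.
Qed.

Section TwoUsers.
Variables (R : realType) (m : nat) (p r : R) (pi0 : 'rV[R]_2).
Variables (PD : nat -> R) (W : config 2 m -> R) (A : policy R 2).
Hypotheses (p01 : 0 <= p <= 1) (r01 : 0 <= r <= 1) (rp : r <= p).
Hypothesis pi01 : forall i, 0 <= pi0 0 i <= 1.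
Hypothesis lawW : sequential_law p r pi0 PD W.
Local Notation history := (history p r pi0 A).
Local Notation belief := (belief p r m pi0).

(** Feedback from [l] slots before the target arrives in time iff its delay is below [l], whence the
    partial sums of [PD]. *)
Definition belief_value (n : nat) (b : 'rV[R]_2) : R :=
  value p r (fun l => \sum_(d < l) PD d) n (b 0 0) (b 0 1).

Lemma ord2_cases (i : 'I_2) : i = 0 \/ i = 1.
Proof. by case: i => -[|[|]] // i2; [left|right]; apply: val_inj. Qed.

(** The right side does not mention [j]: scheduling user [0] unfolds [value], and scheduling user
    [1] gives the same by symmetry of [probe]. *)
Lemma belief_value_step (k t : nat) (z : config 2 m) (j : 'I_2) :
  (k <= t < m)%N ->
  \sum_(o : option 'I_(t.+1 - k)) arrival_weight PD o *
    \sum_x belief_value (t - k)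
             (belief (new_entry t.+1 j x o :: history k t.+1 z) t) *
           belief_weight (belief (history k t.+1 z) t.+1) x =
  belief_value (t.+1 - k) (belief (history k t.+1 z) t.+1).
Proof.
move=> ktm; set h := history k t.+1 z; set b := belief h t.+1.
have b01 i : 0 <= b 0 i <= 1 by apply: belief_ge0_le1.
pose T := belief_step p r.
pose V := value p r (fun l => \sum_(d < l) PD d) (t - k).
pose v c := if j == 0 then V (T (bit_val R c)) (T (b 0 1))
            else V (T (b 0 0)) (T (bit_val R c)).
rewrite big_option /=.
transitivity ((1 - \sum_(d < t.+1 - k) PD d) *
    V (T (b 0 0)) (T (b 0 1)) +
  (\sum_(d < t.+1 - k) PD d) * \sum_c v c * bernoulli_weight (b 0 j) c).
  congr (_ * _ + _).
    under eq_bigr => x _ do rewrite /belief_value !belief_next_entry // !andbF.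
    have := sum_belief_weight b j (fun=> V (T (b 0 0)) (T (b 0 1))).
    by rewrite -mulr_sumr sum_bernoulli_weight mulr1.
  rewrite mulr_suml; apply: eq_bigr => d _; congr (_ * _).
  rewrite -sum_belief_weight; apply: eq_bigr => x _; congr (_ * _).
  rewrite /belief_value !belief_next_entry // !andbT /v.
  by case: (ord2_cases j) => ->.
rewrite subSn; last by lia.
rewrite /belief_value value_probe; congr (_ + _ * _).
have -> : \sum_c v c * bernoulli_weight (b 0 j) c =
    b 0 j * v true + (1 - b 0 j) * v false.
  by rewrite big_bool /=; ring.
rewrite /v; case: (ord2_cases j) => -> //=.
(* User [1] is scheduled: [probeC] moves the observation to this user, and [valueC] then restores
   the order of the arguments. *)
rewrite probeC // /probe /=.
have T01 x : 0 <= x <= 1 -> 0 <= T x <= 1.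
  exact: (iter_step_ge0_le1 1 p01 r01).
by congr (_ * _ + _ * _); apply: valueC => //; apply: T01; rewrite ?lexx ?ler01.
Qed.

(** The value has constant mean along the belief process, and at slot [m] it is a number in which
    the policy does not occur. *)
Lemma mean_belief_value (k t : nat) : (0 < k)%N -> (k <= t <= m)%N ->
  mean W (fun z => belief_value (t - k) (belief (history k t z) t)) =
  mean W (fun=> belief_value (m - k) pi0).
Proof.
move=> k0; move: t; apply: downward_ind => [|t ktm <-].
  by apply: eq_mean => z; rewrite history_nil belief_nil.
rewrite (mean_history_step lawW A (fun h => belief_value (t - k) (belief h t))) //.
by apply: eq_mean => z /=; apply: belief_value_step.
Qed.

Lemma belief_le_value (b : 'rV[R]_2) (i : 'I_2) : b 0 i <= belief_value 0 b.
Proof. by rewrite le_max; case: (ord2_cases i) => ->; rewrite lexx ?orbT. Qed.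

Lemma greedy_value (b : 'rV[R]_2) (i : 'I_2) :
  (forall j, b 0 j <= b 0 i) -> b 0 i = belief_value 0 b.
Proof.
move=> bi; apply/eqP; rewrite eq_le belief_le_value /=.
by rewrite ge_max !bi.
Qed.

End TwoUsers.

(** * Optimality of the greedy policy on configurations *)

Definition config_reward (R : realType) (N m : nat) (p r : R) (pi0 : 'rV[R]_N)
    (A : policy R N) (z : config N m) : R :=
  total_reward p r m pi0 A (config_chan z) (config_delay z).

Lemma current_belief_history (R : realType) (N m : nat) (p r : R)
    (pi0 : 'rV[R]_N) (A : policy R N) (z : config N m) (t : nat) :
  current_belief p r m pi0 A (config_chan z) (config_delay z) t =
  belief p r m pi0 (history p r pi0 A t t z) t.
Proof. by []. Qed.

Section Greedy.
Variables (R : realType) (m : nat) (p r : R) (pi0 : 'rV[R]_2).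
Variables (PD : nat -> R) (W : config 2 m -> R) (A G : policy R 2).
Hypotheses (p01 : 0 <= p <= 1) (r01 : 0 <= r <= 1) (rp : r <= p).
Hypothesis pi01 : forall i, 0 <= pi0 0 i <= 1.
Hypothesis lawW : sequential_law p r pi0 PD W.
Hypothesis W_ge0 : forall z, 0 <= W z.
Hypothesis greedyG : greedy G.

Lemma mean_reward_greedy :
  mean W (config_reward p r pi0 A) <= mean W (config_reward p r pi0 G).
Proof.
(* Each slot [t] serves as its own target. The largest belief there bounds the reward of [A] and
   equals the reward of [G]. *)
pose best B t (z : config 2 m) :=
  belief_value p r PD 0 (belief p r m pi0 (history p r pi0 B t t z) t).
apply: (@le_trans _ _ (mean W (fun z => \sum_(1 <= t < m.+1) best A t z))).
  apply: ler_sum => z _; apply: ler_wpM2l => //; apply: ler_sum => t _.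
  by rewrite current_belief_history; apply: belief_le_value.
have -> : mean W (config_reward p r pi0 G) =
    mean W (fun z => \sum_(1 <= t < m.+1) best G t z).
  apply: eq_mean => z; apply: eq_bigr => t _.
  rewrite current_belief_history; apply: greedy_value => j.
  exact: greedyG.
have mean_best B : mean W (fun z => \sum_(1 <= t < m.+1) best B t z) =
    \sum_(1 <= t < m.+1) mean W (fun=> belief_value p r PD (m - t) pi0).
  rewrite /mean; under eq_bigr do rewrite mulr_sumr.
  rewrite exchange_big /=; apply: eq_big_nat => t /andP[t0 tm].
  have := mean_belief_value B p01 r01 rp pi01 lawW t0 (t := t).
  by rewrite leqnn /= -ltnS tm subnn; apply.
by rewrite !mean_best.
Qed.

End Greedy.

(** * From the probability space to configurations *)

Section DownlinkConfig.
Variables (R : realType) (N m : nat).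
Variables (d : measure_display) (Omega : measurableType d).
Variable P : probability Omega R.
Variable chan : nat -> 'I_N -> Omega -> bool.
Variable delay : 'I_N -> nat -> Omega -> nat.
Hypothesis chan_meas : forall (t : nat) (i : 'I_N), (1 <= t <= m)%N ->
  measurable_fun setT (chan t i).
Hypothesis delay_meas : forall (i : 'I_N) (t : nat), (1 <= t <= m)%N ->
  measurable_fun setT (delay i t).

(** Slot 0 gets a constant, as the model grants measurability only in slots [1] to [m]. *)
Definition config_of (w : Omega) : config N m :=
  [ffun s : 'I_m.+1 => [ffun i =>
    if s == 0 then (false, 0) else (chan s i w, inord (minn (delay i s w) m))]].

Definition config_prob (z : config N m) : R := fine (P [set w | config_of w = z]).

Lemma config_chan_of (w : Omega) (t : nat) (i : 'I_N) : (0 < t <= m)%N ->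
  config_chan (config_of w) t i = chan t i w.
Proof.
move=> /andP[t0 tm]; rewrite /config_chan !ffunE -val_eqE /= inordK //=.
by rewrite gtn_eqF.
Qed.

Lemma config_delay_of (w : Omega) (t : nat) (i : 'I_N) : (0 < t <= m)%N ->
  config_delay (config_of w) i t = minn (delay i t w) m.
Proof.
move=> /andP[t0 tm]; rewrite /config_delay !ffunE -val_eqE /= inordK //=.
by rewrite gtn_eqF //= inordK // ltnS geq_minr.
Qed.

(** There are finitely many configurations, each cut out by finitely many coordinate events. *)
Lemma measurable_config_of (S : set (config N m)) :
  measurable [set w | S (config_of w)].
Proof.
have -> : [set w | S (config_of w)] =
    \bigcup_(z in S) \bigcap_(s in [set: 'I_m.+1]) \bigcap_(i in [set: 'I_N])
      [set w | config_of w s i = z s i].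
  apply/seteqP; split=> [w Sw|w [z Sz zw]] /=; first by exists (config_of w).
  suff -> : config_of w = z by [].
  by apply/ffunP => s; apply/ffunP => i; apply: zw.
apply: fin_bigcup_measurable; first exact: finite_finset.
move=> z _; apply: fin_bigcap_measurable => [|s _].
  exact: finite_finset.
apply: fin_bigcap_measurable => [|i _]; first exact: finite_finset.
have [s0|s0] := eqVneq s 0.
  rewrite (_ : [set w | _] = [set w | (false, 0) = z s i]).
    by case: (asboolP ((false, 0) = z s i)) => zs;
      [rewrite (_ : [set w | _] = setT) // | rewrite (_ : [set w | _] = set0) //];
      apply/seteqP; split.
  by apply/seteqP; split=> w /=; rewrite !ffunE s0 eqxx.
have s1 : (1 <= s <= m)%N by apply/andP; split; [rewrite lt0n | rewrite -ltnS].
rewrite (_ : [set w | _] = chan s i @^-1` [set (z s i).1] `&`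
    delay i s @^-1` [set n | inord (minn n m) = (z s i).2]).
  apply: measurableI; rewrite -[X in measurable X]setTI.
  - exact: chan_meas.
  - exact: delay_meas.
apply/seteqP; split=> w /=; rewrite !ffunE (negbTE s0); case: (z s i) => a b /=.
  by case.
by case=> -> ->.
Qed.

Lemma expectation_config (f : config N m -> R) :
  ('E_P[fun w => f (config_of w)] = (mean config_prob f)%:E)%E.
Proof.
rewrite unlock.
have mC z : measurable [set w | config_of w = z].
  exact: (measurable_config_of [set z]).
transitivity (\int[P]_w (\sum_z (f z)%:E * (\1_[set w | config_of w = z] w)%:E))%E.
  apply: eq_integral => w _.
  rewrite (bigD1 (config_of w)) //= big1 ?adde0 => [|z zw].
    by rewrite indicE mem_set //= mule1.
  by rewrite indicE memNset ?mule0 // => /= wz; rewrite wz eqxx in zw.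
rewrite integral_sum //; last first.
  by move=> z; apply: integrableZl => //; apply: integrable_indic.
rewrite /mean -sumEFin; apply: eq_bigr => z _.
rewrite integralZl //; last exact: integrable_indic.
rewrite integral_indic // setIT muleC EFinM fineK //.
exact: fin_num_measure.
Qed.

Lemma prob_config (S : pred (config N m)) :
  P [set w | S (config_of w)] = (mean config_prob (fun z => (S z)%:R))%:E.
Proof.
rewrite -expectation_config -expectation_indic; last first.
  exact: (measurable_config_of [set z | S z]).
congr expectation; apply/funext => w; rewrite indicE; congr (nat_of_bool _)%:R.
by apply/idP/idP; rewrite inE.
Qed.

End DownlinkConfig.

(** * Factorization of the probability over one slot *)

Section Downlink.
Variables (R : realType) (N m : nat) (p r : R) (PD : nat -> R) (pi0 : 'rV[R]_N).
Variables (d : measure_display) (Omega : measurableType d).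
Variable P : probability Omega R.
Variable chan : nat -> 'I_N -> Omega -> bool.
Variable delay : 'I_N -> nat -> Omega -> nat.
Hypothesis model : downlink_model p r PD m pi0 P chan delay.

(** The past conditioned on is represented by a sample point [w0] that has it. *)
Definition path_weight (w0 : Omega) (t : nat) (i : 'I_N) (c : bool) : R :=
  if t == m then bernoulli_weight (pi0 0 i) c
  else trans_prob p r (chan t.+1 i w0) c.

Lemma prob_user_step (w0 : Omega) (t : nat) (i : 'I_N) (c : bool) :
  (0 < t <= m)%N ->
  P [set w | forall s : 'I_m,
       ((t < s.+1)%N -> chan s.+1 i w = chan s.+1 i w0) /\
       (s.+1 = t -> chan s.+1 i w = c)] =
  ((path_weight w0 t i c)%:E * P [set w | forall s : 'I_m,
       (t < s.+1)%N -> chan s.+1 i w = chan s.+1 i w0])%E.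
Proof.
move=> /andP[t0 tm]; rewrite /path_weight; case: eqVneq => [tE|tne].
  rewrite [X in (_ * P X)%E](_ : _ = setT); last first.
    by apply/seteqP; split=> // w _ s; have := ltn_ord s; lia.
  rewrite probability_setT mule1.
  rewrite [X in P X](_ : _ = [set w | chan m i w = c]); last first.
    apply/seteqP; split=> [w ws|w wc s] /=.
      have m1 : (m.-1 < m)%N by lia.
      have := (ws (Ordinal m1)).2 => /=.
      by have -> : m.-1.+1 = m; [lia|rewrite tE; apply].
    by split=> [|->]; [have := ltn_ord s; lia|rewrite tE].
  case: c => /=; first exact: (chan_initial model).
  rewrite EFinB -(chan_initial model) -probability_setC.
    by congr (P _); apply/seteqP; split=> w /=; case: (chan m i w).
  rewrite -[X in measurable X]setTI.
  have mm : (1 <= m <= m)%N by lia.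
  exact: (chan_measurable model i mm measurableT (Y := [set true])).
have tm' : (1 <= t < m)%N by lia.
have := chan_markov model i (fun s => if s == t then c else chan s i w0) tm'.
rewrite eqxx gtn_eqF // => markov.
transitivity (P [set w | forall s, (t <= s <= m)%N ->
    chan s i w = if s == t then c else chan s i w0]).
  congr (P _); apply/seteqP; split=> w /= ws s.
    move=> /andP[ts sm]; have s1 : (s.-1 < m)%N by lia.
    have [] := ws (Ordinal s1); rewrite /= prednK; last by lia.
    by case: eqVneq => [st _|st + _]; [apply|apply; lia].
  have sm := ltn_ord s; split=> st; have := ws s.+1.
    by rewrite gtn_eqF //; apply; lia.
  by rewrite st eqxx; apply; lia.
rewrite markov; congr (_ * P _)%E; apply/seteqP; split=> w /= ws s.
  move=> ts; have := ltn_ord s; have := ws s.+1.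
  by rewrite gtn_eqF // => h sm; apply: h; lia.
move=> /andP[ts sm]; rewrite gtn_eqF //; have s1 : (s.-1 < m)%N by lia.
by have := ws (Ordinal s1); rewrite /= prednK; [apply|lia].
Qed.

Definition same_past (w0 : Omega) (t : nat) (w : Omega) : Prop :=
  forall (i : 'I_N) (s : 'I_m), (t < s.+1)%N ->
    chan s.+1 i w = chan s.+1 i w0 /\
    minn (delay i s.+1 w) m = minn (delay i s.+1 w0) m.

(** Independence is applied twice, to the past with slot [t] ([C1], [B1]) and to the past alone
    ([C0], [B0]). The two products differ by one transition factor per user and by the factor of the
    delay of [i0] in slot [t]. *)
Lemma prob_slot_step (w0 : Omega) (t : nat) (x : 'I_N -> bool) (i0 : 'I_N)
    (B : set nat) : (0 < t <= m)%N ->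
  P [set w | same_past w0 t w /\
             ((forall i, chan t i w = x i) /\ B (delay i0 t w))] =
  ((\prod_i path_weight w0 t i (x i))%:E * P [set w | B (delay i0 t w)] *
   P [set w | same_past w0 t w])%E.
Proof.
(* Index [s] of ['I_m] stands for slot [s.+1], so slot [t] has index [t.-1]. *)
move=> t0m; have t1 : (t.-1 < m)%N by lia.
have tE : t.-1.+1 = t by lia.
pose C1 i := [set f : {ffun 'I_m -> bool} | forall s : 'I_m,
  ((t < s.+1)%N -> f s = chan s.+1 i w0) /\ (s.+1 = t -> f s = x i)].
pose C0 i := [set f : {ffun 'I_m -> bool} | forall s : 'I_m,
  (t < s.+1)%N -> f s = chan s.+1 i w0].
pose B0 i (s : 'I_m) := [set n | (t < s.+1)%N ->
  minn n m = minn (delay i s.+1 w0) m].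
pose B1 i (s : 'I_m) := [set n | B0 i s n /\ (s.+1 = t -> i = i0 -> B n)].
transitivity (P [set w | (forall i, C1 i [ffun s : 'I_m => chan s.+1 i w]) /\
                         (forall i (s : 'I_m), B1 i s (delay i s.+1 w))]).
  congr (P _); apply/seteqP; split=> w /=.
    move=> [past [wx wB]]; split=> [i s|i s].
      rewrite ffunE; split=> [ts|->]; last exact: wx.
      by have [] := past i s ts.
    split=> [ts|-> ->//]; by have [] := past i s ts.
  move=> [wC wB]; split=> [i s ts|].
    split; first by have [+ _] := wC i s; rewrite ffunE; apply.
    by have [+ _] := wB i s; apply.
  split=> [i|].
    by have [_] := wC i (Ordinal t1); rewrite ffunE /= tE; apply.
  by have [_] := wB i0 (Ordinal t1); rewrite /= tE; apply.
rewrite (model_independent model C1 B1).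
transitivity (((\prod_i path_weight w0 t i (x i))%:E *
     P [set w | B (delay i0 t w)]) *
   P [set w | (forall i, C0 i [ffun s : 'I_m => chan s.+1 i w]) /\
              (forall i (s : 'I_m), B0 i s (delay i s.+1 w))])%E; last first.
  congr (_ * P _)%E; apply/seteqP; split=> w /=.
    move=> [wC wB] i s ts; split; last exact: wB.
    by have := wC i s ts; rewrite ffunE.
  move=> past; split=> [i s ts|i s ts]; last by have [] := past i s ts.
  by rewrite ffunE; have [] := past i s ts.
rewrite (model_independent model C0 B0) muleACA; congr (_ * _)%E.
  rewrite -prodEFin -big_split /=; apply: eq_bigr => i _.
  transitivity (P [set w | forall s : 'I_m,
       ((t < s.+1)%N -> chan s.+1 i w = chan s.+1 i w0) /\
       (s.+1 = t -> chan s.+1 i w = x i)]).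
    congr (P _); apply/seteqP; split=> w ws s;
      by have := ws s; rewrite /= ffunE.
  rewrite prob_user_step //; congr (_ * P _)%E.
  by apply/seteqP; split=> w ws s; have := ws s; rewrite /= ffunE.
pose u := Ordinal t1.
rewrite (bigD1 i0) //= (bigD1 u) //=.
rewrite [X in (_ = _ * X)%E](bigD1 i0) //= [X in (_ = _ * (X * _))%E](bigD1 u) //=.
rewrite !muleA; congr (_ * _ * _)%E; rewrite /B1 /B0 /u.
- rewrite [X in (_ = _ * P X)%E](_ : _ = setT).
    rewrite probability_setT mule1; congr (P _); apply/seteqP; split=> w /=.
      by move=> [_]; rewrite tE; apply.
    by rewrite tE => wB; split=> //; rewrite ltnn.
  by apply/seteqP; split=> w //= _; rewrite tE ltnn.
- apply: eq_bigr => s su; congr (P _); apply/seteqP; split=> w /=; first by case.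
  move=> wB; split=> // st; case/eqP: su; apply: val_inj => /=; lia.
- apply: eq_bigr => i ii0; apply: eq_bigr => s _.
  congr (P _); apply/seteqP; split=> w /=; first by case.
  by move=> wB; split=> // _ ii; rewrite ii eqxx in ii0.
Qed.

End Downlink.

(** * The model induces a sequential law *)

Section DownlinkLaw.
Variables (R : realType) (N m : nat) (p r : R) (PD : nat -> R) (pi0 : 'rV[R]_N).
Variables (d : measure_display) (Omega : measurableType d).
Variable P : probability Omega R.
Variable chan : nat -> 'I_N -> Omega -> bool.
Variable delay : 'I_N -> nat -> Omega -> nat.
Hypothesis model : downlink_model p r PD m pi0 P chan delay.
Local Notation config_of := (config_of m chan delay).
Local Notation W := (@config_prob R N m d Omega P chan delay).

(** A canonical representative of the configurations agreeing before slot [t], so that sums can be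
    partitioned by the past. *)
Definition past (t : nat) (z : config N m) : config N m :=
  [ffun s : 'I_m.+1 => if (t < s)%N then z s else [ffun=> (false, 0)]].

Lemma pastP (t : nat) (z y : config N m) :
  reflect (agree_before t z y) (past t z == past t y).
Proof.
apply: (iffP eqP) => [zy s /andP[ts sm]|zy].
  by have /ffunP/(_ (inord s)) := zy; rewrite !ffunE inordK // ts.
apply/ffunP => s; rewrite !ffunE; case: ifP => // ts.
by have := zy s; rewrite inord_val; apply; rewrite ts -ltnS /=.
Qed.

Lemma past_config_of (t : nat) (w w0 : Omega) :
  past t (config_of w) == past t (config_of w0) <->
  same_past m chan delay w0 t w.
Proof.
split=> [/pastP ww0 i s ts|same].
  have sm : (0 < s.+1 <= m)%N := ltn_ord s.
  rewrite -!(config_chan_of chan delay _ _ sm) -!(config_delay_of chan delay _ _ sm).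
  by rewrite /config_chan /config_delay ww0 // ts /=.
apply/pastP => s /andP[ts sm]; apply/ffunP => i.
have s1 : (s.-1 < m)%N by lia.
have st : (t < s.-1.+1)%N by lia.
have := same i (Ordinal s1) st; rewrite /= prednK; last by lia.
move=> [cE dE]; rewrite !ffunE -!val_eqE /= !inordK //.
by case: ifP => // _; rewrite cE dE.
Qed.

(** Both [psi] and [a] are constant on each class of equal past, so the identity may be checked
    class by class. A class met by no sample point has weight zero, which leaves those of the form
    given by some [w0]. *)
Lemma mean_condition (t : nat) (psi a : config N m -> R) (S : pred (config N m)) :
  depends_before t psi -> depends_before t a ->
  (forall w0, mean W (fun z => (S z && (past t z == past t (config_of w0)))%:R) =
    a (config_of w0) *
    mean W (fun z => (past t z == past t (config_of w0))%:R)) ->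
  mean W (fun z => psi z * (S z)%:R) = mean W (fun z => psi z * a z).
Proof.
move=> psit at' SE; rewrite /mean (partition_big (past t) xpredT) //=.
rewrite [RHS](partition_big (past t) xpredT) //=; apply: eq_bigr => y _.
have [[w0 wy]|none] := pselect (exists w0, past t (config_of w0) = y); last first.
  have W0 z : past t z == y -> W z = 0.
    move=> /eqP zy; rewrite /config_prob (_ : [set w | _] = set0) ?measure0 //.
    by apply/seteqP; split=> // w /= wz; case: none; exists w; rewrite wz.
  by rewrite !big1 // => z /W0->; rewrite mul0r.
have cond (f : config N m -> R) :
    \sum_(z | past t z == y) W z * f z =
    mean W (fun z => f z * (past t z == past t (config_of w0))%:R).
  rewrite big_mkcond; apply: eq_bigr => z _; rewrite wy.
  by case: ifP; rewrite ?mulr1 ?mulr0.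
rewrite !cond.
have local (f g : config N m -> R) : depends_before t f ->
    mean W (fun z => f z * g z * (past t z == past t (config_of w0))%:R) =
    f (config_of w0) *
    mean W (fun z => g z * (past t z == past t (config_of w0))%:R).
  move=> ft; rewrite -meanZ; apply: eq_mean => z.
  by case: pastP => [/ft->|]; rewrite ?mulr1 ?mulr0.
rewrite !local //; congr (_ * _).
transitivity (mean W (fun z => (S z && (past t z == past t (config_of w0)))%:R)).
  by apply: eq_mean => z; rewrite -natrM mulnb.
rewrite SE; transitivity
    (a (config_of w0) * mean W (fun z => 1 * (past t z == past t (config_of w0))%:R)).
  by congr (_ * _); apply: eq_mean => z; rewrite mul1r.
by rewrite -(local a (fun=> 1)) //; apply: eq_mean => z; rewrite mulr1.
Qed.

Lemma state_weight_local (t : nat) (x : {ffun 'I_N -> bool}) :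
  (0 < t <= m)%N ->
  depends_before t (fun z : config N m => state_weight p r pi0 z t x).
Proof.
move=> tm z y zy; apply: eq_bigr => i _; case: eqVneq => // tne.
by rewrite /config_chan zy //; lia.
Qed.

Lemma state_weight_config_of (w0 : Omega) (t : nat) (x : {ffun 'I_N -> bool}) :
  (0 < t <= m)%N -> state_weight p r pi0 (config_of w0) t x =
  \prod_i path_weight m p r pi0 chan w0 t i (x i).
Proof.
move=> tm; apply: eq_bigr => i _; rewrite /path_weight; case: eqVneq => // tne.
by rewrite config_chan_of //; lia.
Qed.

Lemma config_state_of (w : Omega) (t : nat) (x : {ffun 'I_N -> bool}) :
  (0 < t <= m)%N ->
  config_state (config_of w) t == x <-> forall i, chan t i w = x i.
Proof.
move=> tm; split=> [/eqP <- i|wx]; first by rewrite ffunE config_chan_of.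
by apply/eqP/ffunP => i; rewrite ffunE config_chan_of.
Qed.

Lemma mean_slot_step (w0 : Omega) (t : nat) (x : {ffun 'I_N -> bool})
    (i0 : 'I_N) (S : pred (config N m)) (B : set nat) (b : R) :
  (0 < t <= m)%N -> (forall w, S (config_of w) <-> B (delay i0 t w)) ->
  P [set w | B (delay i0 t w)] = b%:E ->
  mean W (fun z => ((config_state z t == x) && S z &&
                    (past t z == past t (config_of w0)))%:R) =
  b * state_weight p r pi0 (config_of w0) t x *
  mean W (fun z => (past t z == past t (config_of w0))%:R).
Proof.
move=> tm SB Pb; apply: EFin_inj; rewrite EFinM.
have chanM := chan_measurable model; have delayM := delay_measurable model.
rewrite -(prob_config P chanM delayM (fun z => past t z == past t (config_of w0))).
rewrite -(prob_config P chanM delayM (fun z => (config_state z t == x) && S z &&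
  (past t z == past t (config_of w0)))).
rewrite state_weight_config_of // mulrC EFinM -Pb.
rewrite [X in (_ * P X)%E](_ : _ = [set w | same_past m chan delay w0 t w]);
  last first.
  by apply/seteqP; split=> w /= /past_config_of.
rewrite -(prob_slot_step model) //; congr (P _); apply/seteqP; split=> w /=.
  move=> /andP[/andP[/config_state_of wx /SB wB] /past_config_of ww0].
  by split=> //; split=> //; apply: wx.
by move=> [/past_config_of-> [/config_state_of-> // /SB->]].
Qed.

Lemma downlink_sequential_law (i0 : 'I_N) : sequential_law p r pi0 PD W.
Proof.
split=> [t psi x tm psit|t psi x i n tm nm psit].
  apply: (mean_condition (t := t) (S := fun z => config_state z t == x)) => //.
    exact: (state_weight_local x tm).
  move=> w0; rewrite -[state_weight _ _ _ _ _ _]mul1r.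
  (* The states alone are the case of a trivial delay event, of probability 1. *)
  rewrite -(mean_slot_step w0 x (i0 := i0) (S := xpredT) (B := setT)) //.
    by apply: eq_mean => z; rewrite andbT.
  exact: probability_setT.
transitivity (mean W (fun z => psi z * (PD n * state_weight p r pi0 z t x))).
  transitivity (mean W (fun z => psi z *
      ((config_state z t == x) && (config_delay z i t == n))%:R)).
    by apply: eq_mean => z; rewrite -mulrA -natrM mulnb.
  apply: (mean_condition (t := t) (S := fun z =>
    (config_state z t == x) && (config_delay z i t == n))) => //.
    by move=> z y zy; rewrite (state_weight_local x tm zy).
  move=> w0.
  apply: (mean_slot_step w0 x (i0 := i) (S := fun z => config_delay z i t == n)
    (B := [set n])) => // [w|]; last exact: (delay_law model).
  (* Since [n < m], the capped delay equals [n] iff the true delay does. *)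
  rewrite config_delay_of // /=; split=> [/eqP/= dn|/= ->].
    lia.
  by apply/eqP; lia.
by rewrite -meanZ; apply: eq_mean => z; rewrite mulrCA.
Qed.

End DownlinkLaw.

(** * The reward depends only on the configuration *)

Section TotalReward.
Variables (R : realType) (N m : nat) (p r : R) (pi0 : 'rV[R]_N) (A : policy R N).
Variables (chan chan' : nat -> 'I_N -> bool) (delay delay' : 'I_N -> nat -> nat).
Hypothesis chanE : forall t i, (0 < t <= m)%N -> chan t i = chan' t i.
Hypothesis delayE : forall t i, (0 < t <= m)%N ->
  minn (delay i t) m = minn (delay' i t) m.

(** A delay of at least [m] never lets feedback from a slot up to [m] arrive, and smaller delays
    survive the capping. *)
Lemma eq_entries (k : nat) (ds : seq (nat * 'I_N)) : (0 < k)%N ->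
  all (fun sa => 0 < sa.1 <= m)%N ds ->
  entries chan delay k ds = entries chan' delay' k ds.
Proof.
move=> k0 /allP ds_m; apply/eq_in_map => -[s i] /ds_m /= sm.
rewrite chanE //; congr Entry; have := delayE i sm.
case: ifPn; case: ifPn => // h1 h2 h3; try lia.
by congr (Some (_, _)); lia.
Qed.

Lemma eq_decisions (n : nat) : (n <= m)%N ->
  decisions p r m pi0 A chan delay n = decisions p r m pi0 A chan' delay' n /\
  all (fun sa => 0 < sa.1 <= m)%N (decisions p r m pi0 A chan delay n).
Proof.
elim: n => // n IHn nm; have [dE dm] := IHn (ltnW nm); split=> /=.
  by rewrite /decide eq_entries ?dE -?dE //; lia.
by rewrite dm andbT; lia.
Qed.

Lemma eq_total_reward :
  total_reward p r m pi0 A chan delay = total_reward p r m pi0 A chan' delay'.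
Proof.
apply: eq_big_nat => t /andP[t0 tm]; have tm' : (m - t <= m)%N by lia.
have [dE dm] := eq_decisions tm'.
by rewrite /current_belief /decision /decide eq_entries // dE.
Qed.

End TotalReward.

Theorem proposition2 (R : realType) (p r : R) (PD : nat -> R) (m : nat)
    (pi0 : 'rV[R]_2)
    (d : measure_display) (Omega : measurableType d) (P : probability Omega R)
    (chan : nat -> 'I_2 -> Omega -> bool) (delay : 'I_2 -> nat -> Omega -> nat)
    (G : policy R 2)
    (hp : 0 <= p <= 1) (hr : 0 <= r <= 1) (hpr : r < p)
    (hPD : is_pmf PD) (hm : (0 < m)%N)
    (hpi0 : forall i, 0 <= pi0 0 i <= 1)
    (hmodel : downlink_model p r PD m pi0 P chan delay)
    (hG : greedy G) :
  forall A : policy R 2,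
    (sum_throughput p r m pi0 P chan delay A <=
     sum_throughput p r m pi0 P chan delay G)%E.
Proof.
(* The common nonnegative factor [m%:R^-1] reduces the claim to expected total rewards, which are
   then computed as finite means over configurations. *)
move=> A; apply: lee_wpmul2r; first by rewrite lee_fin invr_ge0.
have rewardE B : expected_reward p r m pi0 P chan delay B =
    (mean (@config_prob R 2 m d Omega P chan delay)
          (config_reward p r pi0 B))%:E.
  rewrite -(expectation_config P (chan_measurable hmodel) (delay_measurable hmodel)).
  congr expectation; apply/funext => w; apply: eq_total_reward => t i tm.
    by rewrite config_chan_of.
  by rewrite config_delay_of // -minnA minnn.
rewrite !rewardE lee_fin.
apply: (mean_reward_greedy A hp hr (ltW hpr) hpi0 _ _ hG).
  exact: downlink_sequential_law hmodel 0.
by move=> z; rewrite fine_ge0.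
Qed.
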